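(* Let $ABC$ be a triangle, and let $\mathcal{E}$ be the elliptic curve given in homogeneous barycentric coordinates $(x,y,z)$ with respect to $ABC$ by $$\mathcal{E}:\quad x^2(y+z)+y^2(x+z)+z^2(x+y)-2xyz=0 .$$ The locus of points $P$, not lying on the (extended) sides of the triangles $ABC$ or $K^{-1}(ABC)$, for which $\mathsf{M}=T_P\circ K^{-1}\circ T_{P'}$ is a half-turn, coincides with the set of points whose barycentric coordinates lie in $\mathcal{E}-\{A,B,C,A_\infty,B_\infty,C_\infty\}$.
   Context: We work in the real affine plane, extended by the line at infinity $l_\infty$ to the real projective plane (so $\mathcal{E}$ is considered as its set of real points). $G$ is the centroid of $ABC$; $K$ is the complement map, i.e. the homothety with center $G$ and ratio $-\tfrac12$, so $K^{-1}(ABC)$ is the anticomplementary triangle. $P'=\iota(P)$, where $\iota$ is the isotomic map of $ABC$: in homogeneous barycentric coordinates $\iota(x:y:z)=(1/x:1/y:1/z)$. $T_P$ is the unique affine map taking $A,B,C$ respectively to the vertices $D=AP\cdot BC$, $E=BP\cdot CA$, $F=CP\cdot AB$ of the cevian triangle of $P$ (the dot denotes intersection of lines); $T_{P'}$ is the analogous map for $P'$. A half-turn is a point reflection, i.e. a homothety of ratio $-1$ about an ordinary point (a point not on $l_\infty$). The points $A_\infty=BC\cdot l_\infty=(0,1,-1)$, $B_\infty=AC\cdot l_\infty=(1,0,-1)$, $C_\infty=AB\cdot l_\infty=(1,-1,0)$ are the infinite points on the sides of $ABC$, and $A=(1,0,0)$, $B=(0,1,0)$, $C=(0,0,1)$;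 these six points lie on $\mathcal{E}$. *)

(* Defs.v *)
From mathcomp Require Import all_boot all_order all_algebra.
From mathcomp Require Import boolp classical_sets reals.

Set Implicit Arguments.
Unset Strict Implicit.
Unset Printing Implicit Defensive.

Import Order.TTheory GRing.Theory Num.Theory.
Local Open Scope classical_set_scope.
Local Open Scope ring_scope.

(* The real affine plane is 'rV[R]_2.  The real projective plane extending it
   is the set of 1-dimensional subspaces of 'rV[R]_(2 + 1), an affine point p
   being identified with the line spanned by (p, 1).  Projective lines are the
   2-dimensional subspaces, so that [(U + V)%VS] is the line joining two points and
   [(L :&: M)%VS] is the intersection point of two lines. *)
Definition homog (R : realType) (p : 'rV[R]_2) : 'rV[R]_(2 + 1) :=
  row_mx p (const_mx 1).

Definition proj (R : realType) (p : 'rV[R]_2) : {vspace 'rV[R]_(2 + 1)} :=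
  <[homog p]>%VS.

Definition is_proj_point (R : realType) (P : {vspace 'rV[R]_(2 + 1)}) : Prop :=
  \dim P = 1%N.

Definition line_at_infinity (R : realType) : {vspace 'rV[R]_(2 + 1)} :=
  lker (linfun (@rsubmx R 1 2 1)).

Definition line (R : realType) (p q : 'rV[R]_2) : {vspace 'rV[R]_(2 + 1)} :=
  (proj p + proj q)%VS.

Definition is_triangle (R : realType) (A B C : 'rV[R]_2) : Prop :=
  free [:: B - A; C - A].

Definition on_sides (R : realType) (A B C : 'rV[R]_2)
    (P : {vspace 'rV[R]_(2 + 1)}) : Prop :=
  [\/ (P <= line B C)%VS, (P <= line C A)%VS | (P <= line A B)%VS].

(* The point with homogeneous barycentric coordinates (x : y : z); it is the
   zero subspace, hence not a point, when x = y = z = 0. *)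
Definition bary (R : realType) (A B C : 'rV[R]_2) (x y z : R) :
    {vspace 'rV[R]_(2 + 1)} :=
  <[x *: homog A + y *: homog B + z *: homog C]>%VS.

Definition isotomic (R : realType) (A B C : 'rV[R]_2)
    (P P' : {vspace 'rV[R]_(2 + 1)}) : Prop :=
  exists x y z : R, [/\ x != 0, y != 0 & z != 0] /\
    P = bary A B C x y z /\ P' = bary A B C x^-1 y^-1 z^-1.

Definition homothety (R : realType) (O : 'rV[R]_2) (k : R) (p : 'rV[R]_2) :
    'rV[R]_2 := O + k *: (p - O).

Definition is_half_turn (R : realType) (f : 'rV[R]_2 -> 'rV[R]_2) : Prop :=
  exists O : 'rV[R]_2, f = homothety O (-1).

Definition centroid (R : realType) (A B C : 'rV[R]_2) : 'rV[R]_2 :=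
  3%:R^-1 *: (A + B + C).

Definition complement (R : realType) (A B C : 'rV[R]_2) :
    'rV[R]_2 -> 'rV[R]_2 :=
  homothety (centroid A B C) (- 2%:R^-1).

Definition anticomplement (R : realType) (A B C : 'rV[R]_2) :
    'rV[R]_2 -> 'rV[R]_2 :=
  homothety (centroid A B C) (- 2%:R).

Lemma homothetyK (R : realType) (O : 'rV[R]_2) (k l : R) :
  l * k = 1 -> cancel (homothety O k) (homothety O l).
Proof.
by move=> lk p; rewrite /homothety (addrC O (k *: _)) addrK scalerA lk scale1r
  addrC subrK.
Qed.

Lemma complementK (R : realType) (A B C : 'rV[R]_2) :
  cancel (complement A B C) (anticomplement A B C).
Proof. by apply: homothetyK; rewrite mulrNN divff// pnatr_eq0. Qed.

Lemma anticomplementK (R : realType) (A B C : 'rV[R]_2) :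
  cancel (anticomplement A B C) (complement A B C).
Proof. by apply: homothetyK; rewrite mulrNN mulVf// pnatr_eq0. Qed.

Definition is_affine (R : realType) (T : 'rV[R]_2 -> 'rV[R]_2) : Prop :=
  exists (L : 'M[R]_2) (b : 'rV[R]_2), forall p, T p = p *m L + b.

(* [T] is T_P: it is affine and maps A, B, C to the (ordinary) points
   AP.BC, BP.CA, CP.AB.  At most one such [T] exists, by lemma
   [cevian_map_uniq]. *)
Definition cevian_map (R : realType) (A B C : 'rV[R]_2)
    (P : {vspace 'rV[R]_(2 + 1)}) (T : 'rV[R]_2 -> 'rV[R]_2) : Prop :=
  [/\ is_affine T,
      proj (T A) = ((proj A + P) :&: line B C)%VS,
      proj (T B) = ((proj B + P) :&: line C A)%VS &
      proj (T C) = ((proj C + P) :&: line A B)%VS].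

Lemma proj_inj (R : realType) : injective (@proj R).
Proof.
move=> p q pq; have : homog p \in proj q by rewrite -pq memv_line.
case/vlineP => k; rewrite /homog scale_row_mx => /eq_row_mx[-> /matrixP/(_ 0 0)].
by rewrite !mxE mulr1 => <-; rewrite scale1r.
Qed.

Lemma triangle_coord (R : realType) (A B C : 'rV[R]_2) :
  is_triangle A B C ->
  forall p, exists b c : R, p = A + (b *: (B - A) + c *: (C - A)).
Proof.
move=> ABC p; have : p - A \in <<[:: B - A; C - A]>>%VS.
  suff -> : <<[:: B - A; C - A]>>%VS = fullv by rewrite memvf.
  apply/eqP; rewrite eqEdim subvf dimvf /dim /= mul1n.
  by move: ABC => /eqP ->.
rewrite span_cons span_seq1 => /memv_addP[_ /vlineP[b ->]].
by case=> _ /vlineP[c ->] e; exists b, c; rewrite -e addrC subrK.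
Qed.

Lemma cevian_map_uniq (R : realType) (A B C : 'rV[R]_2)
    (P : {vspace 'rV[R]_(2 + 1)}) (T U : 'rV[R]_2 -> 'rV[R]_2) :
  is_triangle A B C -> cevian_map A B C P T -> cevian_map A B C P U -> T = U.
Proof.
move=> ABC [[L [b TE]] TA TB TC] [[M [c UE]] UA UB UC].
have eA : T A = U A by apply: proj_inj; rewrite TA UA.
have eB : T B = U B by apply: proj_inj; rewrite TB UB.
have eC : T C = U C by apply: proj_inj; rewrite TC UC.
have lin (N : 'M[R]_2) (d : 'rV[R]_2) (F : 'rV[R]_2 -> 'rV[R]_2) : (forall p, F p = p *m N + d) ->
    forall s t, F (A + (s *: (B - A) + t *: (C - A))) =
      F A + (s *: (F B - F A) + t *: (F C - F A)).
  move=> FE s t; have sub x y : F x - F y = (x - y) *m N.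
    by rewrite !FE mulmxBl opprD addrACA subrr addr0.
  by rewrite !sub !scalemxAl !FE !mulmxDl [LHS]addrAC.
apply: boolp.funext => p; have [s [t ->]] := triangle_coord ABC p.
by rewrite (lin _ _ _ TE) (lin _ _ _ UE) eA eB eC.
Qed.

(* "M = T_P o K^{-1} o T_{P'} is a half-turn", where P' is the isotomic
   conjugate of P. *)
Definition M_half_turn (R : realType) (A B C : 'rV[R]_2)
    (P : {vspace 'rV[R]_(2 + 1)}) : Prop :=
  exists (P' : {vspace 'rV[R]_(2 + 1)}) (T T' : 'rV[R]_2 -> 'rV[R]_2),
    [/\ isotomic A B C P P', cevian_map A B C P T, cevian_map A B C P' T' &
        is_half_turn (T \o anticomplement A B C \o T')].

Definition half_turn_locus (R : realType) (A B C : 'rV[R]_2) :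
    set {vspace 'rV[R]_(2 + 1)} :=
  [set P | [/\ is_proj_point P, ~ on_sides A B C P,
    ~ on_sides (anticomplement A B C A) (anticomplement A B C B)
               (anticomplement A B C C) P &
    M_half_turn A B C P]].

Definition curve (R : realType) (A B C : 'rV[R]_2) :
    set {vspace 'rV[R]_(2 + 1)} :=
  [set P | is_proj_point P /\ exists x y z : R, P = bary A B C x y z /\
    x ^+ 2 * (y + z) + y ^+ 2 * (x + z) + z ^+ 2 * (x + y)
      - 2%:R * x * y * z = 0].

Definition infinite_point (R : realType) (p q : 'rV[R]_2) :
    {vspace 'rV[R]_(2 + 1)} :=
  (line p q :&: line_at_infinity R)%VS.

Lemma infinite_pointE (R : realType) (p q : 'rV[R]_2) :
  infinite_point p q = <[homog p - homog q]>%VS.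
Proof.
apply/vspaceP => v; rewrite memv_cap memv_ker lfunE /=.
apply/andP/vlineP => [[/memv_addP[_ /vlineP[a ->] [_ /vlineP[b ->] ->]]]|[k ->]].
  move=> /eqP/matrixP/(_ 0 0).
  rewrite /homog !scale_row_mx add_row_mx row_mxKr !mxE !mulr1 => /eqP.
  rewrite addr_eq0 => /eqP ->; exists (- b).
  by rewrite opp_row_mx add_row_mx scale_row_mx !scalerDr !scalerN !scaleNr !opprK.
split.
  apply: memvZ; apply: memv_add; rewrite ?memvN; exact: memv_line.
by rewrite /homog opp_row_mx add_row_mx scale_row_mx row_mxKr subrr scaler0.
Qed.

(* Main.v *)
Require Import Defs.
From mathcomp Require Import all_boot all_order all_algebra.
From mathcomp Require Import boolp classical_sets reals.
From mathcomp Require Import ring.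

Import GRing.Theory Num.Theory.
Local Open Scope classical_set_scope.
Local Open Scope ring_scope.

(** The proof is a computation in homogeneous barycentric coordinates
    P = (x : y : z), P' = (1/x : 1/y : 1/z), built on one identity.  Put
    Pi = (x + y)(y + z)(z + x).  If xyz and Pi are nonzero, then all the cevian
    feet are ordinary points, and for every point p
      M(p) = N - mu p,   mu = 4xyz / Pi,
    where N is a vector that does not depend on p ([M_formula]).  So M is a
    homothety of ratio - mu (a translation if mu = -1), and it is a half-turn
    exactly when mu = 1, that is when Pi - 4xyz = 0.  Expanding Pi shows that
    Pi - 4xyz is the cubic defining E ([cubicE]).

    Two affine maps that agree at A, B, C are equal, so [M_formula] needs
    checking only at the vertices, and the cyclic symmetry A -> B -> C reduces
    this to the vertex A ([M_vertex]).

    It remains to match the excluded points.  The lines y + z = 0, z + x = 0,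
    x + y = 0 are the sides of the anticomplementary triangle.  On E one has
    Pi = 4xyz, so a point of E off the sides of ABC is also off these lines.
    On the side x = 0 the cubic becomes yz(y + z), whose zeros are B, C and the
    infinite point of BC ([curve_side]); so the six removed points are exactly
    the points of E on the sides of ABC. *)

(** * Barycentric frames *)

Lemma vlineZ (K : fieldType) (V : vectType K) (k : K) (v : V) :
  k != 0 -> (<[k *: v]> = <[v]>)%VS.
Proof.
move=> k0; apply/eqP; rewrite eqEsubv -!memvE memvZ ?memv_line //=.
by rewrite -[v in v \in _](scalerK k0) memvZ ?memv_line.
Qed.

Lemma triangle_indep {R : realType} {A B C : 'rV[R]_2} :
  is_triangle A B C -> forall y z : R,
  y *: (B - A) + z *: (C - A) = 0 -> y = 0 /\ z = 0.
Proof.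
rewrite /is_triangle free_cons seq1_free span_seq1 => /andP[BA CA] y z e.
have [y0|y0] := eqVneq y 0.
  split=> //; move/eqP: e; rewrite y0 scale0r add0r scaler_eq0 (negPf CA) orbF.
  by move/eqP.
case/negP: BA; apply/vlineP; exists (- (y^-1 * z)).
move/eqP: e; rewrite addr_eq0 => /eqP e.
by rewrite -[LHS](scalerK y0) e scalerN scalerA scaleNr.
Qed.

Lemma homog_comb {R : realType} (A B C : 'rV[R]_2) (x y z : R) :
  x *: homog A + y *: homog B + z *: homog C =
  row_mx (x *: A + y *: B + z *: C) (const_mx (x + y + z)).
Proof.
rewrite /homog !scale_row_mx !add_row_mx; congr row_mx.
by apply/matrixP => i j; rewrite !mxE !mulr1.
Qed.

Lemma homog_indep {R : realType} {A B C : 'rV[R]_2} :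
  is_triangle A B C -> forall x y z : R,
  x *: homog A + y *: homog B + z *: homog C = 0 -> [/\ x = 0, y = 0 & z = 0].
Proof.
move=> ABC x y z; rewrite homog_comb -[0]row_mx0 => /eq_row_mx[e s].
have {}s : x = - (y + z).
  move/matrixP/(_ 0 0): s; rewrite !mxE -addrA => /eqP.
  by rewrite addr_eq0 => /eqP.
have [|y0 z0] := triangle_indep ABC y z.
  rewrite -[RHS]e s; apply/matrixP => i j; rewrite !mxE; ring.
by rewrite s y0 z0 addr0 oppr0.
Qed.

Lemma homog_coord_inj {R : realType} {A B C : 'rV[R]_2} :
  is_triangle A B C -> forall x y z x' y' z' : R,
  x *: homog A + y *: homog B + z *: homog C =
    x' *: homog A + y' *: homog B + z' *: homog C ->
  [/\ x = x', y = y' & z = z'].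
Proof.
move=> ABC x y z x' y' z' /eqP; rewrite -subr_eq0 => /eqP e.
have [|/eqP + /eqP + /eqP] := homog_indep ABC (x - x') (y - y') (z - z').
  rewrite -[RHS]e; apply/matrixP => i j; rewrite !mxE; ring.
by rewrite !subr_eq0 => /eqP-> /eqP-> /eqP->.
Qed.

(** With [bary_rot] and [anticomplement_rot], this lets each statement about
    one vertex or side be proved once and transported to the other two. *)
Lemma triangle_rot {R : realType} {A B C : 'rV[R]_2} :
  is_triangle A B C -> is_triangle B C A.
Proof.
move=> ABC; rewrite /is_triangle free_cons seq1_free span_seq1.
apply/andP; split.
  apply/vlineP => -[k e]; have [|_ /eqP] := triangle_indep ABC (k - 1) 1.
    move/eqP: e; rewrite -subr_eq0 => /eqP e; rewrite -[RHS]e.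
    apply/matrixP => i j; rewrite !mxE; ring.
  by rewrite oner_eq0.
apply/eqP => e; have [|/eqP] := triangle_indep ABC 1 0.
  by rewrite scale1r scale0r addr0 -opprB e oppr0.
by rewrite oner_eq0.
Qed.

Lemma bary_rot {R : realType} (A B C : 'rV[R]_2) (x y z : R) :
  bary A B C x y z = bary B C A y z x.
Proof. by rewrite /bary -addrA addrC. Qed.

(** * Sides of the triangle and of its anticomplementary triangle *)

Lemma anticomplementE {R : realType} (A B C p : 'rV[R]_2) :
  anticomplement A B C p = A + B + C - 2%:R *: p.
Proof.
rewrite /anticomplement /homothety /centroid.
by apply/matrixP => i j; rewrite !mxE; field.
Qed.

Lemma anticomplement_rot {R : realType} (A B C : 'rV[R]_2) :
  anticomplement A B C = anticomplement B C A.
Proof.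
apply: funext => p; rewrite !anticomplementE; congr (_ - _).
by rewrite -addrA addrC.
Qed.

Lemma mem_lineP {R : realType} (p q : 'rV[R]_2) (v : 'rV[R]_(2 + 1)) :
  reflect (exists b c, v = b *: homog p + c *: homog q) (v \in line p q).
Proof.
apply: (iffP memv_addP) => [[_ /vlineP[b ->] [_ /vlineP[c ->] ->]]|[b [c ->]]].
  by exists b, c.
by exists (b *: homog p); rewrite ?memvZ ?memv_line //;
   exists (c *: homog q); rewrite ?memvZ ?memv_line.
Qed.

Lemma bary_side {R : realType} {A B C : 'rV[R]_2} : is_triangle A B C ->
  forall x y z : R, (bary A B C x y z <= line B C)%VS <-> x = 0.
Proof.
move=> ABC x y z; rewrite -memvE; split=> [/mem_lineP[b [c e]]|->].
  have [|//] := homog_coord_inj ABC x y z 0 b c.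
  by rewrite e scale0r add0r.
by apply/mem_lineP; exists y, z; rewrite scale0r add0r.
Qed.

(** The anticomplements of B and C have coordinates (1 : -1 : 1) and
    (1 : 1 : -1), which span the solutions of y + z = 0. *)
Lemma bary_antiside {R : realType} {A B C : 'rV[R]_2} : is_triangle A B C ->
  forall x y z : R,
  (bary A B C x y z <=
    line (anticomplement A B C B) (anticomplement A B C C))%VS <-> y + z = 0.
Proof.
move=> ABC x y z.
have hB : homog (anticomplement A B C B) = homog A - homog B + homog C.
  rewrite anticomplementE -[homog A]scale1r -[- homog B]scaleN1r.
  rewrite -[homog C]scale1r homog_comb.
  rewrite /homog; congr row_mx; apply/matrixP => i j; rewrite !mxE; ring.
have hC : homog (anticomplement A B C C) = homog A + homog B - homog C.
  rewrite anticomplementE -[homog A]scale1r -[- homog C]scaleN1r.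
  rewrite -[homog B]scale1r homog_comb.
  rewrite /homog; congr row_mx; apply/matrixP => i j; rewrite !mxE; ring.
rewrite -memvE; split=> [/mem_lineP[b [c]]|e].
  rewrite hB hC => e.
  have [|_ -> ->] := homog_coord_inj ABC x y z (b + c) (c - b) (b - c).
    rewrite e; apply/matrixP => i j; rewrite !mxE; ring.
  by rewrite addrC subrKA subrr.
have {e} -> : z = - y by apply/eqP; rewrite -addr_eq0 addrC e.
(* Coefficients solving b + c = x and c - b = y. *)
apply/mem_lineP; exists ((x - y) / 2%:R), ((x + y) / 2%:R); rewrite hB hC.
by apply/matrixP => i j; rewrite !mxE; field.
Qed.

(** * Cevian maps in coordinates *)

(** Eliminating the A-component of P gives its trace on BC.  The identity also
    covers P = A, where both sides are the zero subspace. *)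
Lemma cevian_line_cap {R : realType} {A B C : 'rV[R]_2} : is_triangle A B C ->
  forall x y z : R,
  ((proj A + bary A B C x y z) :&: line B C)%VS =
  <[y *: homog B + z *: homog C]>%VS.
Proof.
move=> ABC x y z; apply/vspaceP => v; rewrite memv_cap.
apply/andP/vlineP => [[]|[t ->]].
  move=> /memv_addP[_ /vlineP[s ->] [_ /vlineP[t ->] ->]] /mem_lineP[b [c e]].
  have [|e0 _ _] := homog_coord_inj ABC (s + t * x) (t * y) (t * z) 0 b c.
    rewrite scale0r add0r -e; apply/matrixP => i j; rewrite !mxE; ring.
  move/eqP: e0; rewrite addr_eq0 => /eqP ->; exists t.
  apply/matrixP => i j; rewrite !mxE; ring.
split; last first.
  by apply/mem_lineP; exists (t * y), (t * z); rewrite scalerDr !scalerA.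
apply/memv_addP; exists (- (t * x) *: homog A).
  by rewrite memvZ ?memv_line.
exists (t *: (x *: homog A + y *: homog B + z *: homog C)).
  by rewrite memvZ ?memv_line.
apply/matrixP => i j; rewrite !mxE; ring.
Qed.

(** The foot is an ordinary point only if y + z is nonzero: y + z is the last
    homogeneous coordinate of the trace of AP on BC, hence zero exactly when
    that trace is at infinity or is not a point. *)
Lemma cevian_footP {R : realType} {A B C : 'rV[R]_2} : is_triangle A B C ->
  forall (x y z : R) (p : 'rV[R]_2),
  proj p = ((proj A + bary A B C x y z) :&: line B C)%VS <->
  y + z != 0 /\ p = (y + z)^-1 *: (y *: B + z *: C).
Proof.
move=> ABC x y z p; rewrite cevian_line_cap //.
have -> : y *: homog B + z *: homog C =
    row_mx (y *: B + z *: C) (const_mx (y + z)).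
  by have := homog_comb A B C 0 y z; rewrite !scale0r !add0r.
split=> [e|[s0 ->]].
  have : homog p \in proj p by exact: memv_line.
  rewrite e => /vlineP[k]; rewrite /homog scale_row_mx => /eq_row_mx[-> ].
  move=> /matrixP/(_ 0 0); rewrite !mxE => ks.
  have s0 : y + z != 0.
    by apply/eqP => s0; move/eqP: ks; rewrite s0 mulr0 oner_eq0.
  split=> //; congr (_ *: _).
  by apply: (mulIf s0); rewrite -ks mulVf.
rewrite -[RHS](vlineZ _ _ (y + z)^-1) ?invr_eq0 // scale_row_mx.
congr (<[row_mx _ _]>%VS).
by apply/matrixP => i j; rewrite !mxE mulVf.
Qed.

Lemma cevian_mapP {R : realType} {A B C : 'rV[R]_2} : is_triangle A B C ->
  forall (x y z : R) (T : 'rV[R]_2 -> 'rV[R]_2),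
  cevian_map A B C (bary A B C x y z) T <->
  [/\ is_affine T, [/\ y + z != 0, z + x != 0 & x + y != 0],
      T A = (y + z)^-1 *: (y *: B + z *: C),
      T B = (z + x)^-1 *: (z *: C + x *: A) &
      T C = (x + y)^-1 *: (x *: A + y *: B)].
Proof.
move=> ABC x y z T.
have BCA := triangle_rot ABC; have CAB := triangle_rot BCA.
rewrite /cevian_map; split.
  case=> aff /(cevian_footP ABC)[s1 ->].
  rewrite bary_rot => /(cevian_footP BCA)[s2 ->].
  by rewrite bary_rot => /(cevian_footP CAB)[s3 ->].
case=> aff [s1 s2 s3] eA eB eC; split=> //.
- exact/(cevian_footP ABC).
- by rewrite bary_rot; apply/(cevian_footP BCA).
- by rewrite 2!bary_rot; apply/(cevian_footP CAB).
Qed.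

(** Cevian maps are obtained from this: the linear part sends the basis
    B - A, C - A to E - D, F - D. *)
Lemma affine_interp {R : realType} {A B C : 'rV[R]_2} : is_triangle A B C ->
  forall D E F : 'rV[R]_2,
  exists T, [/\ is_affine T, T A = D, T B = E & T C = F].
Proof.
move=> ABC D E F.
pose Q : 'M[R]_2 := col_mx (B - A : 'M_(1, 2)) (C - A).
have Qu : Q \in unitmx.
  rewrite -row_free_unit; apply: inj_row_free => v.
  have -> : v = row_mx (lsubmx (v : 'rV_(1 + 1))) (rsubmx (v : 'rV_(1 + 1))).
    by rewrite hsubmxK.
  rewrite [lsubmx _]mx11_scalar [rsubmx _]mx11_scalar.
  rewrite [X in X = 0 -> _](@mul_row_col _ 1 1 1 2).
  rewrite !mul_scalar_mx => /(triangle_indep ABC)[-> ->].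
  by rewrite raddf0 row_mx0.
pose L : 'M[R]_2 := invmx Q *m col_mx (E - D : 'M_(1, 2)) (F - D).
have /eq_col_mx[LB LC] :
    col_mx ((B - A) *m L) ((C - A) *m L) = col_mx (E - D) (F - D).
  by rewrite -[LHS](@mul_col_mx _ 1 1 2 2) mulKVmx.
exists (fun p => p *m L + (D - A *m L)); split.
- by exists L, (D - A *m L).
- by rewrite addrC subrK.
- by move: LB; rewrite mulmxBl addrCA => ->; rewrite addrC subrK.
- by move: LC; rewrite mulmxBl addrCA => ->; rewrite addrC subrK.
Qed.

Lemma affine_comb {R : realType} (T : 'rV[R]_2 -> 'rV[R]_2) :
  is_affine T -> forall (p u v q r : 'rV[R]_2) (s t : R),
  T (p + (s *: (u - v) + t *: (q - r))) =
  T p + (s *: (T u - T v) + t *: (T q - T r)).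
Proof.
case=> L [b TE] p u v q r s t.
have sub m n : T m - T n = (m - n) *m L.
  by rewrite !TE mulmxBl opprD addrACA subrr addr0.
by rewrite !sub !scalemxAl !TE !mulmxDl [LHS]addrAC.
Qed.

Lemma affine_comp {R : realType} (T U : 'rV[R]_2 -> 'rV[R]_2) :
  is_affine T -> is_affine U -> is_affine (T \o U).
Proof.
move=> [L [b TE]] [M [c UE]]; exists (M *m L), (c *m L + b) => p /=.
by rewrite TE UE mulmxDl mulmxA addrA.
Qed.

Lemma affine_scale_trans {R : realType} (k : R) (b : 'rV[R]_2) :
  is_affine (fun p => b - k *: p).
Proof.
by exists (- k%:M), b => p; rewrite mulmxN mul_mx_scalar addrC.
Qed.

Lemma affine_uniq {R : realType} {A B C : 'rV[R]_2} : is_triangle A B C ->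
  forall T U : 'rV[R]_2 -> 'rV[R]_2, is_affine T -> is_affine U ->
  T A = U A -> T B = U B -> T C = U C -> T = U.
Proof.
move=> ABC T U aT aU eA eB eC; apply: funext => p.
have [s [t ->]] := triangle_coord ABC p.
by rewrite (affine_comb _ aT) (affine_comb _ aU) eA eB eC.
Qed.

(** * The map M *)

(** The ratio of the homothety M with its sign changed, so that half-turns
    correspond to the value 1. *)
Definition M_ratio {R : realType} (x y z : R) : R :=
  4%:R * x * y * z / ((x + y) * (y + z) * (z + x)).

(** The three weights add up to 1 + [M_ratio x y z]; when this is nonzero, the
    center of M has coordinates (x(y + z)^2 : y(z + x)^2 : z(x + y)^2). *)
Definition M_shift {R : realType} (A B C : 'rV[R]_2) (x y z : R) : 'rV[R]_2 :=
  ((x + y) * (y + z) * (z + x))^-1 *: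
  ((x * (y + z) ^+ 2) *: A + (y * (z + x) ^+ 2) *: B
    + (z * (x + y) ^+ 2) *: C).

Lemma M_ratio_rot {R : realType} (x y z : R) : M_ratio x y z = M_ratio y z x.
Proof. by rewrite /M_ratio; congr (_ / _); ring. Qed.

Lemma M_shift_rot {R : realType} (A B C : 'rV[R]_2) (x y z : R) :
  M_shift A B C x y z = M_shift B C A y z x.
Proof.
rewrite /M_shift; congr (_^-1 *: _); first by ring.
by rewrite [RHS]addrC addrA.
Qed.

(** The argument of [anticomplement] is the foot D' of AP', which is
    (0 : z : y).  Its anticomplement is A + k (B - C) with
    k = (y - z) / (y + z), a point of the parallel to BC through A.  Applying T
    gives D + k (E - F), and the formula is then an identity of rational
    functions in each coordinate. *)
Lemma M_vertex {R : realType} {A B C : 'rV[R]_2} (x y z : R)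
    (T : 'rV[R]_2 -> 'rV[R]_2) : y != 0 -> z != 0 ->
  y + z != 0 -> z + x != 0 -> x + y != 0 -> is_affine T ->
  T A = (y + z)^-1 *: (y *: B + z *: C) ->
  T B = (z + x)^-1 *: (z *: C + x *: A) ->
  T C = (x + y)^-1 *: (x *: A + y *: B) ->
  T (anticomplement A B C ((y^-1 + z^-1)^-1 *: (y^-1 *: B + z^-1 *: C))) =
  M_shift A B C x y z - M_ratio x y z *: A.
Proof.
move=> y0 z0 s1 s2 s3 aff eA eB eC.
have -> : anticomplement A B C ((y^-1 + z^-1)^-1 *: (y^-1 *: B + z^-1 *: C)) =
    A + (((y - z) / (y + z)) *: (B - C) + 0 *: (B - C)).
  rewrite anticomplementE; apply/matrixP => i j; rewrite !mxE; field.
  by rewrite y0 z0 s1.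
rewrite (affine_comb T aff) scale0r addr0 eA eB eC /M_shift /M_ratio.
apply/matrixP => i j; rewrite !mxE; field.
by rewrite s1 s2 s3.
Qed.

Lemma M_formula {R : realType} {A B C : 'rV[R]_2} : is_triangle A B C ->
  forall (x y z : R) (T T' : 'rV[R]_2 -> 'rV[R]_2),
  x != 0 -> y != 0 -> z != 0 ->
  cevian_map A B C (bary A B C x y z) T ->
  cevian_map A B C (bary A B C x^-1 y^-1 z^-1) T' ->
  T \o anticomplement A B C \o T' =
  (fun p => M_shift A B C x y z - M_ratio x y z *: p).
Proof.
move=> ABC x y z T T' x0 y0 z0.
move=> /(cevian_mapP ABC)[aT [s1 s2 s3] TA TB TC].
move=> /(cevian_mapP ABC)[aT' _ TA' TB' TC'].
apply: (affine_uniq ABC) => /=.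
- apply: affine_comp => //; apply: affine_comp => //.
  suff -> : anticomplement A B C = fun p => A + B + C - 2%:R *: p.
    exact: affine_scale_trans.
  by apply: funext => p; rewrite anticomplementE.
- exact: affine_scale_trans.
- by rewrite TA' (M_vertex x y z).
- rewrite TB' (anticomplement_rot A) (M_vertex y z x) //.
  by rewrite -M_shift_rot -M_ratio_rot.
- rewrite TC' -(anticomplement_rot C) (M_vertex z x y) //.
  by rewrite M_shift_rot M_ratio_rot.
Qed.

(** A half-turn about O is p |-> 2 O - p, so comparing the values at two
    distinct points determines the ratio; conversely the center is b / 2. *)
Lemma half_turn_ratio {R : realType} (k : R) (b : 'rV[R]_2)
    {A B : 'rV[R]_2} : A != B ->
  is_half_turn (fun p => b - k *: p) <-> k = 1.
Proof.
move=> AB; split=> [[O e]|->].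
  have {e} eq p : b - k *: p = 2%:R *: O - p.
    have /(congr1 (fun f => f p)) -> := e; rewrite /homothety.
    by apply/matrixP => i j; rewrite !mxE; ring.
  have : (k - 1) *: (A - B) = 0.
    have <- :
        b - k *: B - (2%:R *: O - B) - (b - k *: A - (2%:R *: O - A)) = 0.
      by rewrite !eq !subrr.
    by apply/matrixP => i j; rewrite !mxE; ring.
  by move/eqP; rewrite scaler_eq0 !subr_eq0 (negPf AB) orbF => /eqP.
exists (2%:R^-1 *: b); apply: funext => p; rewrite /homothety.
by apply/matrixP => i j; rewrite !mxE; field.
Qed.

(** * The cubic and its points on the sides *)

(** In this form the cubic compares the numerator and the denominator of
    [M_ratio], and shows that on the curve xyz <> 0 forces the three sums to be
    nonzero. *)
Lemma cubicE {R : realType} (x y z : R) :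
  x ^+ 2 * (y + z) + y ^+ 2 * (x + z) + z ^+ 2 * (x + y) - 2%:R * x * y * z =
  (x + y) * (y + z) * (z + x) - 4%:R * x * y * z.
Proof. by ring. Qed.

Lemma M_ratio_eq1 {R : realType} (x y z : R) :
  y + z != 0 -> z + x != 0 -> x + y != 0 ->
  M_ratio x y z = 1 <-> (x + y) * (y + z) * (z + x) - 4%:R * x * y * z = 0.
Proof.
move=> s1 s2 s3.
have s0 : (x + y) * (y + z) * (z + x) != 0 by rewrite !mulf_neq0.
rewrite /M_ratio; split=> [e|/eqP].
  by rewrite -[4%:R * x * y * z](divfK s0) e mul1r subrr.
by rewrite subr_eq0 => /eqP <-; rewrite divff.
Qed.

Lemma infinite_pointC {R : realType} (p q : 'rV[R]_2) :
  infinite_point p q = infinite_point q p.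
Proof. by rewrite /infinite_point /line addvC. Qed.

(** The points of the cubic on BC: for x = 0 its equation is yz(y + z) = 0. *)
Lemma curve_side {R : realType} (A B C : 'rV[R]_2) (y z : R) :
  is_proj_point (bary A B C 0 y z) -> y * z * (y + z) = 0 ->
  [set proj B; proj C; infinite_point B C] (bary A B C 0 y z).
Proof.
rewrite /is_proj_point /bary scale0r add0r dim_vline => nz /eqP.
rewrite infinite_pointE !mulf_eq0 -orbA => /or3P[] /eqP e.
- move: nz; rewrite e scale0r add0r; have [->|z0 _] := eqVneq z 0.
    by rewrite scale0r eqxx.
  by left; right; rewrite /= vlineZ.
- move: nz; rewrite e scale0r addr0; have [->|y0 _] := eqVneq y 0.
    by rewrite scale0r eqxx.
  by left; left; rewrite /= vlineZ.
- move/eqP: e nz; rewrite addrC addr_eq0 => /eqP ->.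
  rewrite scaleNr -scalerBr; have [->|y0 _] := eqVneq y 0.
    by rewrite scale0r eqxx.
  by right; rewrite /= vlineZ.
Qed.

Lemma six_points_on_sides {R : realType} (A B C : 'rV[R]_2) :
  [set proj A; proj B; proj C;
       infinite_point B C; infinite_point A C; infinite_point A B]
    `<=` on_sides A B C.
Proof.
move=> P [[[[[]|]|]|]|] /= ->.
- by apply: Or33; exact: addvSl.
- by apply: Or31; exact: addvSl.
- by apply: Or31; exact: addvSr.
- by apply: Or31; exact: capvSl.
- by apply: Or32; rewrite infinite_pointC; exact: capvSl.
- by apply: Or33; exact: capvSl.
Qed.

Theorem theorem3p5 (R : realType) (A B C : 'rV[R]_2)
    (ABC : is_triangle A B C) :
  half_turn_locus A B C =
  curve A B C `\`
    [set proj A; proj B; proj C;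
         infinite_point B C; infinite_point A C; infinite_point A B].
Proof.
have BCA := triangle_rot ABC; have CAB := triangle_rot BCA.
have AB : A != B.
  apply/eqP => e; move: ABC; rewrite /is_triangle e subrr free_cons.
  by rewrite mem0v.
apply/seteqP; split=> P.
  (* The isotomic conjugate provides nonzero coordinates of P, and the cevian
     map of P provides the nonzero sums. *)
  case=> dimP offABC _ [P' [T [T' [[x [y [z [[x0 y0 z0] [eP eP']]]]] cT cT']]]].
  move: dimP offABC cT cT'; rewrite {}eP {}eP' => dimP offABC cT cT'.
  rewrite (M_formula ABC x y z) // (half_turn_ratio _ _ AB).
  have [_ [s1 s2 s3] _ _ _] := (cevian_mapP ABC x y z T).1 cT.
  rewrite M_ratio_eq1 // -cubicE => cubic.
  split; last by move/six_points_on_sides.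
  by split=> //; exists x, y, z.
case=> -[dimP [x [y [z [eP]]]]]; rewrite cubicE {P}eP in dimP * => cubic off6.
(* A vanishing coordinate would put P among the six removed points. *)
have x0 : x != 0.
  apply/eqP => e; apply: off6; move: dimP; rewrite e => dimP.
  have [|[->|->]|->] := curve_side A B C y z dimP.
  - by rewrite -[RHS]cubic e; ring.
  - do 4 left; by right.
  - do 3 left; by right.
  - do 2 left; by right.
have y0 : y != 0.
  apply/eqP => e; apply: off6; move: dimP; rewrite e bary_rot => dimP.
  have [|[->|->]|->] := curve_side B C A z x dimP.
  - by rewrite -[RHS]cubic e; ring.
  - do 3 left; by right.
  - by do 5 left.
  - rewrite (infinite_pointC C); left; by right.
have z0 : z != 0.
  apply/eqP => e; apply: off6; move: dimP; rewrite e -bary_rot => dimP.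
  have [|[->|->]|->] := curve_side C A B x y dimP.
  - by rewrite -[RHS]cubic e; ring.
  - by do 5 left.
  - do 4 left; by right.
  - by right.
have : (x + y) * (y + z) * (z + x) != 0.
  move/eqP: (cubic); rewrite subr_eq0 => /eqP ->.
  by rewrite !mulf_neq0 // pnatr_eq0.
rewrite !mulf_eq0 !negb_or => /andP[/andP[s3 s1] s2].
(* These sums are the denominators of the feet of P'. *)
have inv_sum a b : a != 0 -> b != 0 -> a + b != 0 -> a^-1 + b^-1 != 0 :> R.
  move=> a0 b0 s; have -> : a^-1 + b^-1 = (a + b) / (a * b).
    by field; rewrite a0 b0.
  by rewrite mulf_neq0 ?invr_eq0 ?mulf_neq0.
split=> //.
- case; first by move/(bary_side ABC)/eqP; rewrite (negPf x0).
    by rewrite bary_rot => /(bary_side BCA)/eqP; rewrite (negPf y0).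
  by rewrite 2!bary_rot => /(bary_side CAB)/eqP; rewrite (negPf z0).
- case; first by move/(bary_antiside ABC)/eqP; rewrite (negPf s1).
    rewrite bary_rot anticomplement_rot => /(bary_antiside BCA)/eqP.
    by rewrite (negPf s2).
  rewrite 2!bary_rot 2!anticomplement_rot => /(bary_antiside CAB)/eqP.
  by rewrite (negPf s3).
have ex a b c : b + c != 0 -> c + a != 0 -> a + b != 0 ->
    exists T, cevian_map A B C (bary A B C a b c) T.
  move=> t1 t2 t3.
  have [T [aT TA TB TC]] := affine_interp ABC
    ((b + c)^-1 *: (b *: B + c *: C)) ((c + a)^-1 *: (c *: C + a *: A))
    ((a + b)^-1 *: (a *: A + b *: B)).
  by exists T; apply/(cevian_mapP ABC).
have [T cT] := ex x y z s1 s2 s3.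
have [T' cT'] := ex x^-1 y^-1 z^-1 (inv_sum _ _ y0 z0 s1) (inv_sum _ _ z0 x0 s2)
  (inv_sum _ _ x0 y0 s3).
exists (bary A B C x^-1 y^-1 z^-1), T, T'; split=> //.
  by exists x, y, z.
by rewrite (M_formula ABC x y z) // (half_turn_ratio _ _ AB) M_ratio_eq1.
Qed.
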